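(* Let $\mathbb{K}$ be a field and let $I\subset S=\mathbb{K}[x_1,\ldots,x_n]$ be a nonzero proper squarefree monomial ideal. The asymptotic resurgence $\rho_a(I)$ is equal to the maximum of the skew resurgences $v_a(I)$, taken over the (finitely many, up to positive scaling) skew valuations $v$ supported on $I$ that correspond to defining half-spaces of the Newton polyhedron of $I$. In particular, $\rho_a(I)$ is rational.
   Context: For a squarefree monomial ideal, $I^{(s)}=\bigcap_{P\in\mathrm{Ass}(I)}P^s$. The asymptotic resurgence is $\rho_a(I)=\sup\{\frac{s}{r}: s,r\text{ positive integers},\ I^{(st)}\not\subset I^{rt}\text{ for all } t\gg 0\}$. For $\mathbf{v}=(e_1,\ldots,e_n)\in\mathbb{Z}_{\ge 0}^n$ write $\mathbf{x}^{\mathbf{v}}=\prod x_i^{e_i}$. The Newton polyhedron of $I$ is $\mathrm{NP}(I)=\mathrm{conv}\{\mathbf{v}:\mathbf{x}^{\mathbf{v}}\in I\}\subset\mathbb{R}^n$, the convex hull of the exponent vectors of all monomials in $I$. A skew valuation is a linear functional $v:\mathbb{R}^n\to\mathbb{R}$ that is positive semidefinite, i.e. nonnegative on the first orthant. For $c>0$ let $P_{v,c}=\{\mathbf{v}:v(\mathbf{v})=c\}$ and $H_{v,c}=\{\mathbf{v}:v(\mathbf{v})\ge c\}$. $H_{v,c}$ is a defining half-space of a polyhedron $C$ in the first orthant if $H_{v,c}\supseteq C$ and $C\cap P_{v,c}$ is nonempty of codimension one (dimension $n-1$); $v$ corresponds to a defining half-space if some $H_{v,c}$ is one. For a nonzero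 monomial ideal $J$, $v(J)=\min\{v(\mathbf{v}):\mathbf{x}^{\mathbf{v}}\in J\}$. The skew valuation $v$ is supported on $I$ if $v(I)>0$. The skew Waldschmidt constant is $\widehat{v}(I)=\lim_{s\to\infty}\frac{v(I^{(s)})}{s}$ (positive if $v$ is supported on $I$), and for $v$ supported on $I$ the skew resurgence is $v_a(I)=\frac{v(I)}{\widehat{v}(I)}$ (invariant under positive scaling of $v$). *)

(* Defs.v *)
From HB Require Import structures.
From mathcomp Require Import all_boot all_order all_algebra ring_quotient.
From mathcomp Require Import all_classical all_reals all_analysis.
(* mpoly's notations clash with those of MathComp-Analysis. *)
From mathcomp Require Import -(notations) mpoly.

Set Implicit Arguments.
Unset Strict Implicit.
Unset Printing Implicit Defensive.

Import Order.TTheory GRing.Theory Num.Theory numFieldNormedType.Exports.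

Local Open Scope classical_set_scope.
Local Open Scope ring_scope.

Section Ideals.
Variable A : comNzRingType.

(* Unlike [idealr_closed], this allows the unit ideal. *)
Definition is_ideal (J : set A) : Prop :=
  [/\ J 0, (forall a b, J a -> J b -> J (a + b)) & forall a b, J b -> J (a * b)].

Definition ideal_gen (G : set A) : set A := smallest is_ideal G.

Definition ideal_mul (J L : set A) : set A :=
  ideal_gen [set x | exists a b, [/\ J a, L b & x = a * b]].

Fixpoint ideal_pow (J : set A) (s : nat) : set A :=
  if s is s'.+1 then ideal_mul J (ideal_pow J s') else setT.

Definition is_prime_ideal (P : set A) : Prop :=
  idealr_closed (mem P) /\ prime_idealr_closed (mem P).

Definition Ass (J : set A) : set (set A) :=
  [set P | is_prime_ideal P /\ exists f, P = [set g | J (g * f)]].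

(* Symbolic powers in the form valid for ideals without embedded primes, in
   particular for squarefree monomial ideals. *)
Definition symbolic_pow (J : set A) (s : nat) : set A :=
  \bigcap_(P in Ass J) ideal_pow P s.

Definition asymptotic_resurgence (R : realType) (J : set A) : \bar R :=
  ereal_sup [set x | exists s r : nat,
    [/\ (0 < s)%N, (0 < r)%N, x = (s%:R / r%:R)%:E
      & \forall t \near \oo,
          ~ (symbolic_pow J (s * t) `<=` ideal_pow J (r * t))]].

End Ideals.

Section Monomials.
Variables (K : fieldType) (n : nat).

Definition squarefree_mnm (m : multinom n) : Prop := forall i, (m i <= 1)%N.

Definition squarefree_monomial_ideal (J : set (mpoly n K)) : Prop :=
  exists2 M : set (multinom n), M `<=` squarefree_mnm
    & J = ideal_gen [set mpolyX K m | m in M].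

Variable R : realType.

Definition exponents (J : set (mpoly n K)) : set 'rV[R]_n :=
  [set \row_i (m i)%:R | m in [set m : multinom n | J (mpolyX K m)]].

End Monomials.

Section Polyhedra.
Variables (R : realType) (n : nat).
Implicit Types (C : set 'rV[R]_n) (v : {scalar 'rV[R]_n}).

Definition convex_hull C : set 'rV[R]_n :=
  smallest (@convex_set R 'rV[R]_n) C.

Definition is_affine C : Prop :=
  forall (x y : 'rV[R]_n) (t : R), C x -> C y -> C (t *: x + (1 - t) *: y).

Definition affine_hull C : set 'rV[R]_n := smallest is_affine C.

(* [C] is nonempty and its affine hull is a translate of a [d]-dimensional
   linear subspace. *)
Definition has_dim C (d : nat) : Prop :=
  exists x (W : {vspace 'rV[R]_n}),
    [/\ C !=set0, \dim W = d & affine_hull C = [set x + w | w in [set` W]]].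

Definition skew_valuation v : Prop :=
  forall x : 'rV[R]_n, (forall i, 0 <= x ord0 i) -> 0 <= v x.

Definition hyperplane v (c : R) : set 'rV[R]_n := [set x | v x = c].

Definition half_space v (c : R) : set 'rV[R]_n := [set x | c <= v x].

Definition defining_half_space C v (c : R) : Prop :=
  [/\ 0 < c, C `<=` half_space v c & has_dim (C `&` hyperplane v c) n.-1].

Definition corresponds_to_half_space C v : Prop :=
  exists c, defining_half_space C v c.

End Polyhedra.

Section Skew.
Variables (K : fieldType) (n : nat) (R : realType).
Implicit Types (J : set (mpoly n K)) (v : {scalar 'rV[R]_n}).

Definition newton_polyhedron J : set 'rV[R]_n := convex_hull (exponents J).

(* The minimum of [v] on the exponents of [J] (it exists for a skew valuation
   and a nonzero monomial ideal); the junk value is [0]. *)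
Definition skew_value v J : R :=
  xget 0 (let E := v @` exponents J in E `&` lbound E).

Definition supported v J : Prop := 0 < skew_value v J.

Definition skew_waldschmidt v J : R :=
  limn (fun s : nat => skew_value v (symbolic_pow J s) / s%:R).

Definition skew_resurgence v J : R := skew_value v J / skew_waldschmidt v J.

Definition newton_skew_valuations J : set {scalar 'rV[R]_n} :=
  [set v | [/\ skew_valuation v, supported v J
             & corresponds_to_half_space (newton_polyhedron J) v]].

End Skew.

(* Main.v *)
Require Import Defs.
From HB Require Import structures.
From mathcomp Require Import all_boot all_order all_algebra ring_quotient.
From mathcomp Require Import all_classical all_reals all_analysis.
From mathcomp Require Import -(notations) mpoly.
From mathcomp Require Import ring lra.

Set Implicit Arguments.
Unset Strict Implicit.
Unset Printing Implicit Defensive.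

Import Order.TTheory GRing.Theory Num.Theory numFieldNormedType.Exports.

Local Open Scope classical_set_scope.
Local Open Scope ring_scope.

(** Write exponent vectors as points of R^n, and let [S] be the family of the
    supports of the squarefree monomials of [I].  The primes associated with
    [I] are generated by the variables in the minimal sets that meet all
    members of [S], the minimal covers ([Ass_sqfree]); hence a monomial is in
    the [s]-th symbolic power if and only if its total degree in each minimal
    cover is at least [s] ([symbolic_powP]).

    For a family [G] of subsets of the index set, let [blocking G] be the
    polyhedron of the nonnegative vectors of weight at least [1] on each member
    of [G].  The symbolic powers of [I] are described by
    [blocking (min_covers S)].  The polyhedron [blocking S] consists of the
    linear forms that are nonnegative on the orthant and at least [1] on the
    Newton polyhedron of [I], and its vertices are precisely the normalized
    defining half-spaces of the Newton polyhedron ([facet_of_vertex],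
    [vertex_of_facet]): the constraints tight at a vertex correspond to the
    generators and to the coordinate directions that span a face of codimension
    one.  A polyhedron has finitely many vertices, which proves the finiteness.

    For a skew valuation [v], the Waldschmidt constant is the minimum of [v] on
    [blocking (min_covers S)] ([skew_waldschmidtE]), because the lattice points
    of [s] times that polyhedron approximate it up to a bounded error.  For a
    vertex [u] of [blocking S] the value on [I] is [1], so that the skew
    resurgence is the inverse of the minimum over [x] of [dot u x].  The largest
    of these is [k^-1], for [k] the minimum of [dot u x] over both polyhedra.

    It remains to see that the asymptotic resurgence is [k^-1]
    ([asymptotic_resurgenceE]).  A form [u] that attains the minimum obstructs
    the containments with [s / r < k^-1].  For [s / r > k^-1], the exponents in
    the symbolic power of order [s * t] are deep inside [r * t] times the
    Newton polyhedron; by linear programming duality, a consequence of Farkas'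
    lemma, they dominate real combinations of the generators, and the
    coefficients can be rounded down because the excess grows with [t]
    ([mem_ideal_pow_blocking]).

    The minimum [k] is attained at a pair of vertices [u] and [x]
    ([vertex_descent]).  Vertices of polyhedra with rational constraints are
    rational ([vertex_rational]), and therefore so is the resurgence. *)

Lemma finite_argmin (F : realFieldType) (T : choiceType) (D : set T)
    (f : T -> F) :
  finite_set D -> D !=set0 -> exists2 x, D x & forall y, D y -> f x <= f y.
Proof.
move=> /finite_seqP[s ->] [x0 /= x0s].
have lt0 : (index x0 s < size s)%N by rewrite index_mem.
case: (Order.TotalTheory.arg_minP (fun i : 'I_(size s) => f (nth x0 s i))
  (erefl : xpredT (Ordinal lt0))) => i _ min_i.
exists (nth x0 s i) => [|y ys]; first exact: mem_nth.
have lty : (index y s < size s)%N by rewrite index_mem.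
by have := min_i (Ordinal lty) isT; rewrite /= nth_index.
Qed.

(** * Farkas' lemma *)

Section Farkas.
Variables (F : realFieldType) (V : lmodType F).

(** Induction on the number of forms.  If [a ord0] is redundant the induction
    hypothesis applies.  Otherwise some [z] satisfies the other inequalities
    while [b z < 0], so that [a ord0 z < 0]; projecting along [z] onto the
    kernel of [a ord0] gives a system with one form less. *)
Lemma farkas_ord (m : nat) (a : 'I_m -> V -> F) (b : V -> F) :
    (forall i, scalar (a i)) -> scalar b ->
    (forall x, (forall i, 0 <= a i x) -> 0 <= b x) ->
  exists2 l : 'I_m -> F, (forall i, 0 <= l i) &
    forall x, b x = \sum_i l i * a i x.
Proof.
have scalarB (f : V -> F) : scalar f ->
    forall x k z, f (x - k *: z) = f x - k * f z.
  by move=> lf x k z; rewrite addrC -scaleNr lf mulNr addrC.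
have scalar0 (f : V -> F) : scalar f -> f 0 = 0.
  by move=> lf; have := lf (-1) 0 0; rewrite scaler0 addr0 mulN1r addNr.
elim: m => [|m IH] in a b *.
  move=> _ lb b_ge0; exists (fun=> 0) => // x; rewrite big_ord0.
  apply/eqP; rewrite eq_le b_ge0 ?andbT; last by case.
  have : 0 <= b (0 - 1 *: x) by apply: b_ge0; case.
  by rewrite scalarB // scalar0 // mul1r sub0r oppr_ge0.
move=> la lb ab.
have [all_b|] := pselect (forall x,
    (forall i, 0 <= a (lift ord0 i) x) -> 0 <= b x).
  have [l l_ge0 bE] := IH (fun i => a (lift ord0 i)) b
    (fun i => la _) lb all_b.
  exists (fun i => oapp l 0 (unlift ord0 i)) => [i|x].
    by case: unliftP => [j _|_] /=.
  rewrite bE big_ord_recl unlift_none mul0r add0r.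
  by apply: eq_bigr => i _; rewrite liftK.
move/existsNP => [z /not_implyP[az /negP]]; rewrite -ltNge => bz.
have a0z : a ord0 z < 0.
  rewrite ltNge; apply/negP => a0z; move: bz; apply/negP; rewrite -leNgt.
  by apply: ab => i; have [j ->|->] := unliftP ord0 i.
pose y := (a ord0 z)^-1 *: z.
have scalarZ (f : V -> F) : scalar f -> forall k x, f (k *: x) = k * f x.
  by move=> lf k x; have := lf k x 0; rewrite addr0 scalar0 // addr0.
have a0y : a ord0 y = 1 by rewrite scalarZ // mulVf // lt_eqF.
have by_gt0 : 0 < b y by rewrite scalarZ // nmulr_rgt0 // invr_lt0.
have ay i : a (lift ord0 i) y <= 0.
  by rewrite scalarZ // nmulr_rle0 // invr_lt0.
pose p x := x - a ord0 x *: y.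
have lp f : scalar f -> scalar (f \o p).
  move=> lf k u v /=; rewrite /p !scalarB // lf la; ring.
have [i|||l l_ge0 bE] := IH (fun i => a (lift ord0 i) \o p) (b \o p).
- exact: lp.
- exact: lp.
- move=> x apx; apply: ab => i; have [j ->|->] := unliftP ord0 i.
    exact: apx.
  by rewrite /p scalarB // a0y mulr1 subrr.
pose c := b y - \sum_i l i * a (lift ord0 i) y.
exists (fun i => oapp l c (unlift ord0 i)) => [i|x].
  case: unliftP => [j _|_] /=; first exact: l_ge0.
  rewrite subr_ge0; apply: le_trans (ltW by_gt0).
  by rewrite sumr_le0 // => i' _; rewrite mulr_ge0_le0.
rewrite big_ord_recl unlift_none /=.
under eq_bigr => i _ do rewrite liftK /=.
have := bE x; rewrite /p /= scalarB // => /(canRL (subrK _)) ->.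
under eq_bigr => i _ do rewrite scalarB // mulrBr mulrCA.
rewrite sumrB -mulr_sumr /c; ring.
Qed.

Lemma farkas (T : finType) (a : T -> V -> F) (b : V -> F) :
    (forall t, scalar (a t)) -> scalar b ->
    (forall x, (forall t, 0 <= a t x) -> 0 <= b x) ->
  exists2 l : T -> F, (forall t, 0 <= l t) &
    forall x, b x = \sum_t l t * a t x.
Proof.
move=> la lb ab.
have [i||x ax|l l_ge0 bE] := @farkas_ord #|T| (a \o enum_val) b.
- exact: la.
- exact: lb.
- by apply: ab => t; rewrite -(enum_rankK t); apply: ax.
exists (l \o enum_rank) => [t|x]; first exact: l_ge0.
rewrite bE (reindex _ (onW_bij _ (@enum_rank_bij T))) /=.
by apply: eq_bigr => t _; rewrite enum_rankK.
Qed.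

End Farkas.

(** * Vertices of polyhedra and linear programming duality *)

Section Dot.
Variables (F : comNzRingType) (n : nat).

Definition dot (w x : 'rV[F]_n) : F := \sum_i w ord0 i * x ord0 i.

Lemma dotC w x : dot w x = dot x w.
Proof. by apply: eq_bigr => i _; rewrite mulrC. Qed.

Lemma dot_is_scalar w : scalar (dot w).
Proof.
move=> k x y; rewrite /dot mulr_sumr -big_split /=.
by apply: eq_bigr => i _; rewrite !mxE mulrDr mulrCA.
Qed.

HB.instance Definition _ w :=
  GRing.isLinear.Build F 'rV[F]_n F *%R (dot w) (dot_is_scalar w).

Lemma dotEmx w x : dot w x = (x *m w^T) ord0 ord0.
Proof. by rewrite mxE; apply: eq_bigr => i _; rewrite !mxE mulrC. Qed.

Lemma dot_delta w i : dot w (delta_mx ord0 i) = w ord0 i.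
Proof.
rewrite /dot (bigD1 i) //= mxE !eqxx mulr1 big1 ?addr0 // => j ji.
by rewrite mxE (negPf ji) andbF mulr0.
Qed.

Lemma dot_inj w w' : dot w =1 dot w' -> w = w'.
Proof.
move=> ww'; apply/rowP => i.
by rewrite -!dot_delta ww'.
Qed.

End Dot.

Section Polyhedron.
Variables (F : realFieldType) (n : nat) (T : finType).
Variables (a : T -> 'rV[F]_n) (b : T -> F).

Definition polyhedron : set 'rV[F]_n := [set x | forall t, b t <= dot (a t) x].

Definition vertex : set 'rV[F]_n :=
  [set x | polyhedron x /\
    forall d, (forall t, dot (a t) x = b t -> dot (a t) d = 0) -> d = 0].

(** A vertex is determined by the set of constraints that are tight at it. *)
Lemma vertex_finite : finite_set vertex.
Proof.
pose tight x := [set t | dot (a t) x == b t]%SET.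
have tight_inj : {in vertex &, injective tight}.
  move=> x y /set_mem[_ vx] _ xy; apply/eqP; rewrite -subr_eq0; apply/eqP.
  apply: vx => t tx; have : t \in tight x by rewrite inE tx.
  by rewrite xy inE => /eqP ty; rewrite linearB /= tx ty subrr.
by rewrite -(eq_finite_set (inj_card_eq tight_inj)); apply: finite_finset.
Qed.

(** From a point that is not a vertex one can move along a line on which the
    tight constraints stay tight, in a direction that does not increase [w],
    until a further constraint becomes tight.  The line does leave the
    polyhedron: a direction that decreases [w] is not a recession direction,
    and if [w] is constant on the line, one of its two directions leaves a
    polyhedron that contains no line. *)
Lemma vertex_descent (w : 'rV[F]_n) :
    (forall d, (forall t, dot (a t) d = 0) -> d = 0) ->
    (forall d, (forall t, 0 <= dot (a t) d) -> 0 <= dot w d) ->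
  forall x, polyhedron x -> exists2 y, vertex y & dot w y <= dot w x.
Proof.
move=> pointed wrec x.
(* Induction on the number of constraints that are not tight at [x]. *)
have [k] := ubnP #|[set t | dot (a t) x != b t]%SET|.
elim: k x => // k IH x; rewrite ltnS => le_k Px.
have [vx|] := pselect (vertex x); first by exists x.
move/not_andP => [//|/existsNP[d0 /not_implyP[tight0 d0_neq0]]].
have [d [tight_d wd [t0 dt0]]] : exists d,
    [/\ forall t, dot (a t) x = b t -> dot (a t) d = 0, dot w d <= 0 &
        exists t, dot (a t) d < 0].
  have tightN t : dot (a t) x = b t -> dot (a t) (- d0) = 0.
    by move=> /tight0 d0t; rewrite linearN /= d0t oppr0.
  have neg d : dot w d < 0 -> exists t, dot (a t) d < 0.
    move=> wd; apply/not_existsP => /= all_ge; move: wd; apply/negP.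
    by rewrite -leNgt; apply: wrec => t; rewrite leNgt; apply/negP/all_ge.
  have [wd|wd|wd] := ltrgtP (dot w d0) 0.
  - by exists d0; split=> //; [exact: ltW|exact: neg].
  - have wNd : dot w (- d0) < 0 by rewrite linearN /= oppr_lt0.
    by exists (- d0); split=> //; [exact: ltW|exact: neg].
  have [ex|/forallNP nex] := pselect (exists t, dot (a t) d0 < 0).
    by exists d0; split=> //; rewrite wd.
  exists (- d0); split; [by []|by rewrite linearN /= wd oppr0|].
  apply/not_existsP => nex'; apply: d0_neq0; apply: pointed => t.
  apply/eqP; rewrite eq_le !leNgt; apply/andP; split; last exact/negP/nex.
  by apply/negP => dt; apply: (nex' t); rewrite linearN /= oppr_lt0.
(* The step length at which constraint [t] becomes tight. *)
pose r t := (dot (a t) x - b t) / - dot (a t) d.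
case: (Order.TotalTheory.arg_minP r (dt0 : [pred t | dot (a t) d < 0] t0)).
move=> t1 /= dt1 min_t1.
have r_ge0 : 0 <= r t1.
  by rewrite divr_ge0 // ?subr_ge0 ?Px // oppr_ge0 ltW.
pose y := x + r t1 *: d.
have dy c : dot c y = dot c x + r t1 * dot c d by rewrite linearD linearZ.
have Py : polyhedron y.
  move=> t; rewrite dy; have [td|td] := lerP 0 (dot (a t) d).
    by apply: ler_wpDr (Px t); rewrite mulr_ge0.
  have := min_t1 t td; rewrite {2}/r ler_pdivlMr ?oppr_gt0 // mulrN.
  by move=> h; lra.
have [|//|z vz zy] := IH y.
  apply: leq_trans le_k; apply: proper_card; apply/properP; split.
    apply/fintype.subsetP => t; rewrite !inE; apply: contraNN => /eqP xt.
    by rewrite dy (tight_d t xt) mulr0 addr0 xt.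
  exists t1; rewrite !inE; last first.
    rewrite negbK dy /r; apply/eqP; field.
    by rewrite lt_eqF.
  by apply: contraTN dt1 => /eqP /tight_d ->; rewrite ltxx.
exists z => //; apply: le_trans zy _; rewrite dy gerDl.
by rewrite mulr_ge0_le0.
Qed.


Lemma vertex_minimum (w : 'rV[F]_n) :
    (forall d, (forall t, dot (a t) d = 0) -> d = 0) ->
    (forall d, (forall t, 0 <= dot (a t) d) -> 0 <= dot w d) ->
    polyhedron !=set0 ->
  exists2 y, vertex y & forall x, polyhedron x -> dot w y <= dot w x.
Proof.
move=> pointed wrec [x0 Px0].
have [y0 vy0 _] := vertex_descent pointed wrec Px0.
have [|y vy min_y] := @finite_argmin _ _ vertex (dot w) vertex_finite.
  by exists y0.
exists y => // x Px; have [z vz] := vertex_descent pointed wrec Px.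
exact: le_trans (min_y z vz).
Qed.

(** Non-tight constraints are kept as zero rows: this fixes the shape of the
    matrix without changing its row space. *)
Definition tight_rows (x : 'rV[F]_n) : 'M[F]_(#|T|, n) :=
  \matrix_k (if dot (a (enum_val k)) x == b (enum_val k)
             then a (enum_val k) else 0).

Lemma vertex_row_full x : vertex x -> row_full (tight_rows x).
Proof.
move=> [_ vx]; rewrite -col_leq_rank -mxrank_tr row_leq_rank -kermx_eq0.
apply/rowV0P => d /sub_kermxP dM; apply: vx => t tx.
have := congr1 (fun M : 'rV_ _ => M ord0 (enum_rank t)) dM.
rewrite !mxE => <-; apply: eq_bigr => i _.
by rewrite !mxE enum_rankK tx eqxx mulrC.
Qed.

Lemma vertex_span x w : vertex x ->
  exists y : T -> F, (forall t, dot (a t) x != b t -> y t = 0) /\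
    w = \sum_t y t *: a t.
Proof.
move=> /vertex_row_full full; have /submxP[z ->] := submx_full w full.
exists (fun t => if dot (a t) x == b t then z ord0 (enum_rank t) else 0).
split=> [t /negPf -> //|]; rewrite mulmx_sum_row.
rewrite (reindex _ (onW_bij _ (@enum_rank_bij T))) /=.
apply: eq_bigr => t _; rewrite rowK enum_rankK.
by case: ifP; rewrite ?scale0r ?scaler0.
Qed.

(** The vertex is the only solution of the linear system of its tight
    constraints; a rational system that is solvable over an extension field is
    solvable over the rationals. *)
Lemma vertex_rational (a0 : T -> 'rV[rat]_n) (b0 : T -> rat) x :
    (forall t, a t = map_mx ratr (a0 t)) -> (forall t, b t = ratr (b0 t)) ->
  vertex x -> exists q, x = map_mx ratr q.
Proof.
move=> aE bE /vertex_row_full full.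
pose tight t := dot (a t) x == b t.
pose M := \matrix_(k < #|T|) (if tight (enum_val k) then a0 (enum_val k) else 0).
pose c := \row_(k < #|T|) (if tight (enum_val k) then b0 (enum_val k) else 0).
have ME : tight_rows x = map_mx ratr M.
  apply/matrixP => k i; rewrite !mxE; rewrite -/(tight _); case: ifP => _.
    by rewrite aE mxE.
  by rewrite !mxE rmorph0.
have cE : x *m (tight_rows x)^T = map_mx ratr c.
  apply/rowP => k; rewrite !mxE -/(tight _); case: ifP => tk.
    rewrite -bE -(eqP tk) dotC.
    by apply: eq_bigr => i _; rewrite !mxE -/(tight _) tk.
  rewrite big1 ?rmorph0 // => i _.
  by rewrite !mxE -/(tight _) tk mxE mulr0.
have : (map_mx (@ratr F) c <= map_mx ratr M^T)%MS.
  by rewrite -cE ME map_trmx submxMl.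
rewrite map_submx => /submxP[q cq]; exists q.
have free : row_free (tight_rows x)^T.
  by rewrite -row_leq_rank mxrank_tr col_leq_rank.
by apply: (row_free_inj free); rewrite cE cq map_mxM ME map_trmx.
Qed.

(** Farkas' lemma for the homogenized forms [a t y - b t * h] and [h] on pairs
    [(y, h)]: points with [h > 0] are multiples of points of the polyhedron,
    those with [h = 0] are recession directions. *)
Lemma polyhedron_duality (w : 'rV[F]_n) (c : F) :
    (forall d, (forall t, 0 <= dot (a t) d) -> 0 <= dot w d) ->
    (forall x, polyhedron x -> c <= dot w x) ->
  exists l : T -> F, [/\ forall t, 0 <= l t, w = \sum_t l t *: a t &
    c <= \sum_t l t * b t].
Proof.
move=> wrec wc; pose V := ('rV[F]_n * F^o)%type.
pose f (t : option T) (z : V) : F :=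
  if t is Some t then dot (a t) z.1 - b t * z.2 else z.2.
pose g (z : V) : F := dot w z.1 - c * z.2.
have dotP (v : 'rV[F]_n) (r : F) :
    scalar (fun z : V => dot v z.1 - r * z.2 : F).
  move=> k x y; rewrite /= linearP /= mulrDr mulrBr opprD addrACA.
  by rewrite mulrCA.
have [[t|]||z fz|l l_ge0 gE] := @farkas F V (option T) f g.
- exact: dotP.
- by [].
- exact: dotP.
- have := fz None; rewrite /= le_eqVlt => /predU1P[z2|z2_gt0].
    rewrite /g -z2 mulr0 subr0; apply: wrec => t.
    by have := fz (Some t); rewrite /= -z2 mulr0 subr0.
  have Px : polyhedron (z.2^-1 *: z.1).
    move=> t; rewrite linearZ /= ler_pdivlMl // mulrC -subr_ge0.
    exact: fz (Some t).
  by have := wc _ Px; rewrite linearZ /= ler_pdivlMl // subr_ge0 mulrC.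
have sumE (h : option T -> F) : \sum_t h t = h None + \sum_t h (Some t).
  rewrite (bigD1 None) //=; congr (_ + _).
  rewrite (reindex_omap Some id) => [|[]] //.
  by apply: eq_bigl => t; rewrite /= eqxx.
exists (l \o Some); split=> [t||]; first exact: l_ge0.
- apply: dot_inj => x; have := gE (x, 0).
  rewrite /g /= mulr0 subr0 sumE /= mulr0 add0r => ->.
  rewrite dotC linear_sum /=; apply: eq_bigr => t _.
  by rewrite mulr0 subr0 linearZ /= dotC.
- have := gE (0, 1); rewrite /g linear0 sub0r mulr1 sumE /= mulr1.
  under eq_bigr => t _ do rewrite linear0 sub0r mulr1 mulrN.
  rewrite sumrN => cE; rewrite -subr_ge0.
  have -> : \sum_t l (Some t) * b t - c = l None by rewrite cE; ring.
  exact: l_ge0.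
Qed.

End Polyhedron.

(** * Blocking polyhedra of set families *)

Section Blocking.
Variables (F : realFieldType) (n : nat).
Implicit Types (A C : {set 'I_n}) (G : {set {set 'I_n}}) (w x y d : 'rV[F]_n).

Definition indicator A : 'rV[F]_n := \row_i (i \in A)%:R.

Lemma dot_indicator A x : dot (indicator A) x = \sum_(i in A) x ord0 i.
Proof.
rewrite /dot [RHS]big_mkcond /=; apply: eq_bigr => i _.
by rewrite mxE; case: ifP; rewrite ?mul1r ?mul0r.
Qed.

(** Indices [inl i] give the constraints of the positive orthant; an index
    [inr A] with [A] outside [G] gives the void constraint [0 <= 0], so that
    the index type does not depend on [G]. *)
Definition block_row G (t : 'I_n + {set 'I_n}) : 'rV[F]_n :=
  match t with
  | inl i => delta_mx ord0 i
  | inr A => if A \in G then indicator A else 0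
  end.

Definition block_rhs G (t : 'I_n + {set 'I_n}) : F :=
  if t is inr A then (A \in G)%:R else 0.

Definition blocking G : set 'rV[F]_n :=
  polyhedron (block_row G) (block_rhs G).

Definition block_vertex G : set 'rV[F]_n :=
  vertex (block_row G) (block_rhs G).

Lemma dot_deltal i x : dot (delta_mx ord0 i) x = x ord0 i.
Proof. by rewrite dotC dot_delta. Qed.

Lemma blockingP G x : blocking G x <->
  (forall i, 0 <= x ord0 i) /\ (forall A, A \in G -> 1 <= dot (indicator A) x).
Proof.
split=> [Gx|[x_ge0 Gx] [i|A] /=].
- split=> [i|A AG]; first by have := Gx (inl i); rewrite /= dot_deltal.
  by have := Gx (inr A); rewrite /= AG.
- by rewrite dot_deltal.
by case: ifP => [/Gx //|_]; rewrite dotC linear0.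
Qed.

Lemma dot_ge0 w x :
  (forall i, 0 <= w ord0 i) -> (forall i, 0 <= x ord0 i) -> 0 <= dot w x.
Proof. by move=> w0 x0; apply: sumr_ge0 => i _; apply: mulr_ge0. Qed.

Lemma ler_dot w x y : (forall i, 0 <= w ord0 i) ->
  (forall i, x ord0 i <= y ord0 i) -> dot w x <= dot w y.
Proof. by move=> w0 xy; apply: ler_sum => i _; apply: ler_wpM2l. Qed.

Lemma block_pointed G d : (forall t, dot (block_row G t) d = 0) -> d = 0.
Proof.
by move=> Gd; apply/rowP => i; have := Gd (inl i); rewrite dot_deltal mxE.
Qed.

Lemma block_recession G w : (forall i, 0 <= w ord0 i) ->
  forall d, (forall t, 0 <= dot (block_row G t) d) -> 0 <= dot w d.
Proof.
move=> w_ge0 d Gd; apply: dot_ge0 => // i.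
by have := Gd (inl i); rewrite dot_deltal.
Qed.

Lemma blocking_minimum G w : (forall i, 0 <= w ord0 i) -> finset.set0 \notin G ->
  exists2 x, block_vertex G x & forall y, blocking G y -> dot w x <= dot w y.
Proof.
move=> w_ge0 G0; apply: vertex_minimum.
- exact: block_pointed.
- exact: block_recession.
exists (const_mx 1); apply/blockingP; split=> [i|A AG]; first by rewrite mxE.
have /finset.set0Pn[i iA] : A != finset.set0.
  by apply: contraNneq G0 => <-.
rewrite dot_indicator (bigD1 i) //= mxE lerDl.
by apply: sumr_ge0 => j _; rewrite mxE.
Qed.

Lemma block_vertexP G x : block_vertex G x <-> blocking G x /\
  forall d, (forall i, x ord0 i = 0 -> d ord0 i = 0) ->
    (forall A, A \in G -> dot (indicator A) x = 1 -> dot (indicator A) d = 0) ->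
  d = 0.
Proof.
split=> [[Gx vx]|[Gx vx]]; split=> // d.
  move=> d0 d1; apply: vx => -[i|A] /=; first by rewrite !dot_deltal; apply: d0.
  by case: ifP => [|_ _]; [apply: d1|rewrite dotC linear0].
move=> dt; apply: vx => [i|A AG]; first by have := dt (inl i); rewrite /= !dot_deltal.
by have := dt (inr A); rewrite /= AG.
Qed.

Lemma block_vertex_tight G x A0 : block_vertex G x -> A0 \in G ->
  exists2 A, A \in G & dot (indicator A) x = 1.
Proof.
move=> /block_vertexP[/blockingP[x_ge0 Gx] vx] A0G.
apply: contrapT => /forall2NP nex.
have x0 : x = 0 by apply: vx => // A AG xA; case: (nex A).
by have := Gx _ A0G; rewrite x0 linear0 ler10.
Qed.

Lemma block_vertex_rational G x : block_vertex G x ->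
  exists q, x = map_mx ratr q.
Proof.
apply: (@vertex_rational _ _ _ _ _
  (fun t => match t with
            | inl i => delta_mx ord0 i
            | inr A => if A \in G then \row_i (i \in A)%:R else 0
            end)
  (fun t => if t is inr A then (A \in G)%:R else 0)).
  case=> [i|A] /=; first by rewrite map_delta_mx.
  case: ifP => _; last by rewrite map_mx0.
  by apply/rowP => i; rewrite !mxE rmorph_nat.
by case=> [i|A] /=; rewrite ?rmorph0 ?rmorph_nat.
Qed.

(** The multipliers of the constraints of the orthant are dropped, which turns
    the equality given by duality into a domination. *)
Lemma blocking_duality G w c : (forall i, 0 <= w ord0 i) ->
    (forall x, blocking G x -> c <= dot w x) ->
  exists l : {set 'I_n} -> F, [/\ forall A, 0 <= l A,
    forall i, \sum_(A in G) l A * (i \in A)%:R <= w ord0 i &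
    c <= \sum_(A in G) l A].
Proof.
move=> w_ge0 wc.
have [l [l_ge0 wE cE]] :=
  polyhedron_duality (@block_recession G w w_ge0) wc.
exists (l \o inr); split=> [A|i|]; first exact: l_ge0.
- rewrite wE summxE big_sumType /= [X in _ <= _ + X](_ : _ =
    \sum_(A in G) l (inr A) * (i \in A)%:R).
    rewrite lerDr; apply: sumr_ge0 => j _.
    by rewrite !mxE mulr_ge0.
  rewrite [RHS]big_mkcond /=; apply: eq_bigr => A _.
  by rewrite mxE; case: ifP => _; rewrite mxE ?mulr0.
move: cE; rewrite big_sumType /= big1 ?add0r => [|i _]; last by rewrite mulr0.
rewrite [X in _ -> _ <= X]big_mkcond => /le_trans; apply.
by rewrite le_eqVlt; apply/orP; left; apply/eqP/eq_bigr => A _;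
  case: ifP; rewrite ?mulr1 ?mulr0.
Qed.

Lemma block_vertex_span G x w : block_vertex G x ->
  exists (y : {set 'I_n} -> F) (z : 'I_n -> F), [/\
    forall A, ~ (A \in G /\ dot (indicator A) x = 1) -> y A = 0,
    forall i, x ord0 i != 0 -> z i = 0 &
    w = \sum_A y A *: indicator A + \sum_i z i *: delta_mx ord0 i].
Proof.
move=> /(vertex_span w)[y [y0 wE]].
exists (fun A => if A \in G then y (inr A) else 0), (y \o inl); split.
- move=> A /not_andP[/negP/negPf -> //|xA].
  case: ifP => // AG; apply: y0; rewrite /= AG; exact/eqP.
- by move=> i xi; apply: y0; rewrite /= dot_deltal.
rewrite wE big_sumType /= addrC; congr (_ + _).
by apply: eq_bigr => A _; case: ifP; rewrite ?scaler0 ?scale0r.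
Qed.

End Blocking.

(** * Powers of ideals and monomial weights *)

Section Ideals.
Variable A : comNzRingType.
Implicit Types (J L G : set A).

Lemma ideal_gen_ideal G : is_ideal (ideal_gen G).
Proof.
split=> [J [[]]|x y Jx Jy J JG|x y Jy J JG] //.
- by have [_ JD _] := JG.1; apply: JD; [apply: Jx|apply: Jy].
- by have [_ _ JM] := JG.1; apply: JM; apply: Jy.
Qed.

Lemma ideal_pow_ideal J s : is_ideal (ideal_pow J s).
Proof. by case: s => [|s]; [split|apply: ideal_gen_ideal]. Qed.

Lemma ideal_powM J s x y : J x -> ideal_pow J s y -> ideal_pow J s.+1 (x * y).
Proof. by move=> Jx Jy; apply: sub_gen_smallest; exists x, y. Qed.

Lemma in_memP (P : set A) x : x \in mem P <-> P x.
Proof. by split=> [/set_mem|/mem_set]. Qed.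

Lemma prime_idealM (P : set A) x y : is_prime_ideal P -> P (x * y) -> P x \/ P y.
Proof.
by move=> [_ Pprime] /in_memP/Pprime/orP[] /in_memP; [left|right].
Qed.

Lemma prime_ideal1 (P : set A) : is_prime_ideal P -> ~ P 1.
Proof. by move=> [[_ /negP P1 _] _] /in_memP. Qed.

(** Shows that a prime which contains a finite intersection of ideals contains
    one of them, by choosing an element outside the prime in each. *)
Lemma prime_prod (P : set A) (T : Type) (r : seq T) (g : T -> A) :
  is_prime_ideal P -> (forall t, ~ P (g t)) -> ~ P (\prod_(t <- r) g t).
Proof.
move=> Pprime Pg; apply: (big_ind (fun x => ~ P x)) => //.
  exact: prime_ideal1.
by move=> x y Px Py /(prime_idealM Pprime)[].
Qed.

End Ideals.

Section MonomialIdeals.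
Variables (F : realFieldType) (K : fieldType) (n : nat).
Implicit Types (m : multinom n) (f g : mpoly n K) (J : set (mpoly n K)).
Implicit Types (w : 'rV[F]_n) (B C : {set 'I_n}).

Definition mnm_vec m : 'rV[F]_n := \row_i (m i)%:R.

Lemma mnm_vec_ge0 m i : 0 <= mnm_vec m ord0 i.
Proof. by rewrite mxE. Qed.

Lemma mnm_vecD m1 m2 : mnm_vec (mnm_add m1 m2) = mnm_vec m1 + mnm_vec m2.
Proof. by apply/rowP => i; rewrite !mxE mnmDE natrD. Qed.

Definition mnm_set B : multinom n :=
  Multinom (mktuple (fun i => (i \in B) : nat)).

Lemma mnm_setE B i : mnm_set B i = (i \in B).
Proof. by rewrite mnmE. Qed.

Lemma mnm_vec_set B : mnm_vec (mnm_set B) = indicator F B.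
Proof. by apply/rowP => i; rewrite !mxE mnm_setE. Qed.

Definition mnm_supp m : {set 'I_n} := [set i | m i != 0%N]%SET.

Lemma mnm_set_supp_le m i : (mnm_set (mnm_supp m) i <= m i)%N.
Proof. by rewrite mnm_setE inE; case: (m i). Qed.

Lemma mnm_supp_set B : mnm_supp (mnm_set B) = B.
Proof. by apply/setP => i; rewrite inE mnm_setE; case: (i \in B). Qed.

Lemma mnm_suppD m1 m2 :
  mnm_supp (mnm_add m1 m2) = mnm_supp m1 :|: mnm_supp m2.
Proof. by apply/setP => i; rewrite !inE mnmDE addn_eq0 negb_and. Qed.

Lemma mnm_subK m1 m2 : (forall i, m1 i <= m2 i)%N ->
  mnm_add m1 (mnm_sub m2 m1) = m2.
Proof. by move=> le12; apply/mnmP => i; rewrite mnmDE mnmBE subnKC. Qed.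

Lemma ideal_msupp J f : is_ideal J ->
  (forall m, m \in msupp f -> J (mpolyX K m)) -> J f.
Proof.
move=> [J0 JD JM] Jf; rewrite (mpolyE f) big_seq.
by apply: big_ind => // m mf; rewrite -mul_mpolyC; apply/JM/Jf.
Qed.

Lemma ideal_mnm_le J m1 m2 : is_ideal J -> (forall i, m1 i <= m2 i)%N ->
  J (mpolyX K m1) -> J (mpolyX K m2).
Proof.
move=> [_ _ JM] le12 J1; rewrite -(mnm_subK le12) mpolyXD mulrC; exact: JM.
Qed.

Lemma msupp_closed_ideal (E : set (multinom n)) :
    (forall m1 m2, E m2 -> E (mnm_add m1 m2)) ->
  is_ideal [set f : mpoly n K | forall m, m \in msupp f -> E m].
Proof.
move=> EM; split=> [m|f g Ef Eg m|f g Eg m] /=.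
- by rewrite msupp0.
- by move/msuppD_le; rewrite mem_cat => /orP[/Ef|/Eg].
- by move/msuppM_le => /allpairsP[[m1 m2] /= [_ /Eg ? ->]]; apply: EM.
Qed.

(** Both the powers of the minimal primes of a squarefree monomial ideal and
    the half-spaces that bound its Newton polyhedron are of this form. *)
Definition weight_ideal w (s : F) : set (mpoly n K) :=
  [set f | forall m, m \in msupp f -> s <= dot w (mnm_vec m)].

Lemma weight_idealX w s m :
  weight_ideal w s (mpolyX K m) <-> s <= dot w (mnm_vec m).
Proof.
split=> [|sm m']; first by apply; rewrite msuppX mem_head.
by rewrite msuppX inE => /eqP ->.
Qed.

Lemma weight_ideal_ideal w s : (forall i, 0 <= w ord0 i) ->
  is_ideal (weight_ideal w s).
Proof.
move=> w_ge0; apply: msupp_closed_ideal => m1 m2 sm.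
rewrite mnm_vecD linearD /=; apply: ler_wpDl sm; apply: dot_ge0 => // i.
exact: mnm_vec_ge0.
Qed.

Lemma weight_idealM w s t f g :
  weight_ideal w s f -> weight_ideal w t g -> weight_ideal w (s + t) (f * g).
Proof.
move=> sf tg m /msuppM_le /allpairsP[[m1 m2] /= [/sf ? /tg ? ->]].
by rewrite mnm_vecD linearD lerD.
Qed.

Lemma ideal_pow_weight J w : (forall i, 0 <= w ord0 i) ->
    J `<=` weight_ideal w 1 ->
  forall s, ideal_pow J s `<=` weight_ideal w s%:R.
Proof.
move=> w_ge0 Jw; elim=> [f _ m _|s IH].
  by apply: dot_ge0 => // i; apply: mnm_vec_ge0.
apply: smallest_sub; first exact: weight_ideal_ideal.
by move=> _ [f [g [/Jw Jf /IH Jg ->]]]; rewrite -add1n natrD; apply: weight_idealM.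
Qed.

(** A monomial divisible by a product of [r] squarefree monomials of [J]; the
    factors are indexed by a finite type, with multiplicities [k]. *)
Lemma mem_ideal_pow J (T : finType) (B : T -> {set 'I_n}) (r : nat) :
  forall (k : T -> nat) m,
    (forall t, (0 < k t)%N -> J (mpolyX K (mnm_set (B t)))) ->
    (r <= \sum_t k t)%N -> (forall i, \sum_t k t * (i \in B t) <= m i)%N ->
  ideal_pow J r (mpolyX K m).
Proof.
elim: r => [//|r IH] k m kJ rk km.
have [t kt] : exists t, (0 < k t)%N.
  apply/existsP; apply: contraLR rk => /existsPn k0; rewrite -ltnNge ltnS.
  by rewrite big1 // => t _; apply/eqP; rewrite -leqn0 leqNgt.
(* Split off one factor supported on [B t]. *)
have Bm i : (mnm_set (B t) i <= m i)%N.
  rewrite mnm_setE; apply: leq_trans (km i).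
  rewrite (bigD1 t) //=; apply: leq_trans (leq_addr _ _).
  by rewrite leq_pmull.
rewrite -(mnm_subK Bm) mpolyXD; apply: ideal_powM; first exact: kJ.
pose k' t' := (k t' - (t' == t))%N.
have k'E (c : T -> nat) : (\sum_t' k t' * c t' = c t + \sum_t' k' t' * c t')%N.
  rewrite (bigD1 t) //= [in RHS](bigD1 t) //= addnA; congr (_ + _)%N.
    by rewrite /k' eqxx -mulSn subn1 prednK.
  by apply: eq_bigr => t' /negPf t't; rewrite /k' t't subn0.
apply: (IH k') => [t'||i].
- by rewrite subn_gt0 => /(leq_ltn_trans (leq0n _)) /kJ.
- have := k'E (fun=> 1%N); under eq_bigr do rewrite muln1.
  under [in RHS]eq_bigr do rewrite muln1.
  by move=> sumE; move: rk; rewrite sumE add1n ltnS.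
- rewrite mnmBE mnm_setE leq_subRL; last by have := Bm i; rewrite mnm_setE.
  by rewrite -(k'E (fun t => (i \in B t) : nat)).
Qed.

End MonomialIdeals.

(** * Primary decomposition and symbolic powers *)

Section Blocker.
Variable T : finType.
Implicit Types (A B C : {set T}) (G : {set {set T}}).

Definition is_cover G C := [forall A in G, ~~ (A \subset ~: C)].

Definition min_covers G : {set {set T}} := [set C | minset (is_cover G) C]%SET.

Definition up_closed G := forall A B, A \subset B -> A \in G -> B \in G.

(** The complement of a set that is not in [G] is a cover, and so contains a
    minimal one, which the set does not meet. *)
Lemma mem_blocker G A : up_closed G ->
  A \in G <-> forall C, C \in min_covers G -> ~~ (A \subset ~: C).
Proof.
move=> upG; split=> [AG C|AC].
  by rewrite inE => /minsetp/forall_inP/(_ A AG).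
apply: contrapT => /negP AnG.
have : is_cover G (~: A).
  apply/forall_inP => B BG; apply: contra AnG.
  by rewrite finset.setCK => BA; apply: upG BG.
move=> /minset_exists[C Cmin CA].
have /AC : C \in min_covers G by rewrite inE.
by rewrite finset.subsetC CA.
Qed.

Lemma min_coverN0 G : G != finset.set0 -> finset.set0 \notin min_covers G.
Proof.
move=> /finset.set0Pn[A AG]; apply/negP.
rewrite inE => /minsetp/forall_inP/(_ A AG).
by rewrite finset.subsetC finset.sub0set.
Qed.

Lemma min_cover_sub G C C' : C \in min_covers G -> C' \in min_covers G ->
  C' \subset C -> C' = C.
Proof. by rewrite !inE => /minsetinf Cinf /minsetp; apply: Cinf. Qed.

End Blocker.

Section SquarefreeMonomialIdeals.
Variables (F : realFieldType) (K : fieldType) (n : nat).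
Variable I : set (mpoly n K).
Hypothesis I_sqfree : squarefree_monomial_ideal I.
Hypothesis I_nonzero : exists2 f, I f & f != 0.
Hypothesis I_proper : I <> setT.

(** The supports of all squarefree monomials of [I] rather than of generators,
    which makes the family up-closed and independent of a choice. *)
Definition sqfree_supports : {set {set 'I_n}} :=
  [set A | `[< I (mpolyX K (mnm_set A)) >]]%SET.

Local Notation S := sqfree_supports.
Local Notation covers := (min_covers S).
Local Notation cover_ideal C := (@weight_ideal F K n (indicator F C) 1).

Lemma sqfree_supportsP A : A \in S <-> I (mpolyX K (mnm_set A)).
Proof. by rewrite inE asboolE. Qed.

Lemma sqfree_ideal : is_ideal I.
Proof. by have [M _ ->] := I_sqfree; apply: ideal_gen_ideal. Qed.

Lemma sqfree_supports_up : up_closed S.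
Proof.
move=> A B AB /sqfree_supportsP IA; apply/sqfree_supportsP.
apply: ideal_mnm_le IA; first exact: sqfree_ideal.
move=> i; rewrite !mnm_setE; have := fintype.subsetP AB i.
by case: (i \in A) => // ->.
Qed.

(** This is where squarefreeness matters: a squarefree generator divides a
    monomial as soon as its support is contained in that of the monomial. *)
Lemma mem_sqfree f : I f <-> forall m, m \in msupp f -> mnm_supp m \in S.
Proof.
split=> [|fS]; last first.
  apply: ideal_msupp; first exact: sqfree_ideal.
  move=> m /fS/sqfree_supportsP; apply: ideal_mnm_le; first exact: sqfree_ideal.
  exact: mnm_set_supp_le.
have E_up (m1 m2 : multinom n) :
    mnm_supp m2 \in S -> mnm_supp (mnm_add m1 m2) \in S.
  by apply: sqfree_supports_up; rewrite mnm_suppD finset.subsetUr.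
have [M Msq IE] := I_sqfree; rewrite {1}IE.
move: f; apply: (@smallest_sub _ _ _ [set f : mpoly n K | _]).
  exact: (msupp_closed_ideal _ E_up).
move=> _ /= [m Mm <-] m'; rewrite msuppX inE => /eqP ->.
apply/sqfree_supportsP; rewrite (_ : mnm_set _ = m).
  by rewrite IE; apply: sub_gen_smallest; exists m.
apply/mnmP => i; rewrite mnm_setE inE.
by have := Msq _ Mm i; case: (m i) => [|[]].
Qed.

Lemma sqfree_set0 : finset.set0 \notin S.
Proof.
apply/negP => /sqfree_supportsP I1; apply: I_proper.
apply/seteqP; split=> // f _; have [_ _ IM] := sqfree_ideal.
rewrite -[f]mulr1; apply: IM; rewrite -mpolyX0.
rewrite (_ : mnm0 = mnm_set finset.set0) //.
by apply/mnmP => i; rewrite mnm_setE mnm0E inE.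
Qed.

Lemma sqfree_supports_neq0 : S != finset.set0.
Proof.
have [f If f_neq0] := I_nonzero; apply/finset.set0Pn.
case: (msupp f) (msupp_eq0 f) ((mem_sqfree f).1 If) => [|m s _ fS].
  by rewrite (negPf f_neq0) eqxx.
by exists (mnm_supp m); apply: fS; rewrite mem_head.
Qed.

Lemma indicator_ge0 (A : {set 'I_n}) i : 0 <= indicator F A ord0 i.
Proof. by rewrite mxE. Qed.

Lemma dot_indicator_mnm (A : {set 'I_n}) (m : multinom n) :
  dot (indicator F A) (mnm_vec F m) = (\sum_(i in A) m i)%:R.
Proof.
by rewrite dot_indicator natr_sum; apply: eq_bigr => i _; rewrite mxE.
Qed.

Lemma cover_weight (A : {set 'I_n}) (m : multinom n) :
  (1 <= dot (indicator F A) (mnm_vec F m)) = ~~ (mnm_supp m \subset ~: A).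
Proof.
rewrite dot_indicator_mnm ler1n lt0n sum_nat_eq0; congr (~~ _).
apply/forall_inP/fintype.subsetP => [Am i|mA i iA].
  by rewrite !inE; apply: contra => /Am ->.
by apply: contraTT iA => mi; have := mA i; rewrite !inE mi; apply.
Qed.

(** The primary decomposition of [I], by [mem_blocker] applied to the supports
    of the monomials of [f]. *)
Lemma sqfree_primary f :
  I f <-> forall C, C \in covers -> cover_ideal C f.
Proof.
rewrite mem_sqfree; split=> [fS C CS m /fS|fC m mf].
  by rewrite cover_weight => /(mem_blocker _ sqfree_supports_up).1; apply.
apply/(mem_blocker _ sqfree_supports_up) => C CS.
by rewrite -cover_weight; apply: fC.
Qed.

(** Modulo the ideal, a polynomial may be replaced by the part of it that only
    involves variables outside [C]; polynomials in these variables form a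
    domain which meets the ideal in [0]. *)
Lemma cover_ideal_prime C : is_prime_ideal (cover_ideal C).
Proof.
have [P0 PD PM] := weight_ideal_ideal K 1 (indicator_ge0 C).
split; first split.
- exact/in_memP.
- apply/negP => /in_memP/(_ (@mnm0 n)).
  rewrite cover_weight -mpolyC1 msupp1 mem_head => /(_ isT) /negP; apply.
  by apply/fintype.subsetP => i; rewrite inE mnm0E.
- by move=> a f g /in_memP Pf /in_memP Pg; apply/in_memP; apply/PD/Pg/PM.
move=> f g /in_memP Pfg.
pose free (m : multinom n) := mnm_supp m \subset ~: C.
have split_free (h : mpoly n K) : exists h0 h1, [/\ h = h0 + h1,
    forall m, m \in msupp h0 -> free m & cover_ideal C h1].
  exists (\sum_(m <- msupp h | free m) mcoeff m h *: mpolyX K m).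
  exists (\sum_(m <- msupp h | ~~ free m) mcoeff m h *: mpolyX K m).
  split; first by rewrite {1}(mpolyE h) (bigID free).
    apply: (big_ind (fun h0 : mpoly n K => forall m, m \in msupp h0 -> free m)).
    - by move=> m; rewrite msupp0.
    - by move=> a b fa fb m /msuppD_le; rewrite mem_cat => /orP[/fa|/fb].
    - by move=> m fm m' /msuppZ_le; rewrite msuppX inE => /eqP ->.
  apply: big_ind => // m fm; rewrite -mul_mpolyC; apply: PM.
  by apply/weight_idealX; rewrite cover_weight.
have [f0 [f1 [fE f0free Pf1]]] := split_free f.
have [g0 [g1 [gE g0free Pg1]]] := split_free g.
have Pf0g0 : cover_ideal C (f0 * g0).
  have -> : f0 * g0 = f * g + ((- f) * g1 + (- g0) * f1).
    by rewrite fE gE; ring.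
  by apply: (PD) => //; apply: (PD); apply: (PM).
have : f0 * g0 = 0.
  apply: msuppnil0; case E: (msupp _) => [//|m s].
  have mfg : m \in msupp (f0 * g0) by rewrite E mem_head.
  have := Pf0g0 _ mfg; rewrite cover_weight => /negP[].
  case/allpairsP: (msuppM_le mfg) => -[m1 m2] /= [/f0free m1free /g0free m2free ->].
  by rewrite mnm_suppD finset.subUset; apply/andP.
move/eqP; rewrite mulf_eq0 => /orP[] /eqP h0; apply/orP; [left|right]; apply/in_memP.
  by rewrite fE h0 add0r.
by rewrite gE h0 add0r.
Qed.

(** A colon ideal [I : f] is the intersection of the primes of the minimal
    covers that do not contain [f]; if it is prime, it is one of them.  Conversely
    the prime of [C] is [I : f] for [f] the product of the variables outside
    [C], because no other minimal cover is contained in [C]. *)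
Lemma Ass_sqfree : Ass I = [set cover_ideal C | C in [set` covers]].
Proof.
apply/seteqP; split=> P.
  move=> [Pprime [f PE]]; apply: contrapT => nP.
  (* Elements outside [P] that vanish, times [f], modulo each component. *)
  have /choice[g gP] (C : {set 'I_n}) : exists g : mpoly n K,
      ~ P g /\ (C \in covers -> cover_ideal C (g * f)).
    have [CS|_] := boolP (C \in covers); last first.
      by exists 1; split=> //; apply: prime_ideal1.
    have [Cf|Cf] := pselect (cover_ideal C f).
      by exists 1; rewrite mul1r; split=> // ; apply: prime_ideal1.
    apply: contrapT => /forallNP noP; apply: nP; exists C => //.
    apply/seteqP; split=> g Cg.
      apply: contrapT => Pg; apply: (noP g); split=> // _; rewrite mulrC.
      by have [_ _ PM] := weight_ideal_ideal K 1 (indicator_ge0 C); apply: PM.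
    have : cover_ideal C (g * f).
      by move: Cg; rewrite PE /= => /sqfree_primary; apply.
    by case/(prime_idealM (cover_ideal_prime C)).
  apply: (prime_prod (r := index_enum _) Pprime (fun C => (gP C).1)).
  rewrite PE /=; apply/sqfree_primary => C CS.
  rewrite (bigD1 C) //= mulrAC mulrC.
  have [_ _ PM] := weight_ideal_ideal K 1 (indicator_ge0 C); apply: PM.
  exact: (gP C).2.
move=> [C /= CS <-]; split; first exact: cover_ideal_prime.
have [_ _ PM] := weight_ideal_ideal K 1 (indicator_ge0 C).
exists (mpolyX K (mnm_set (~: C))); apply/seteqP; split=> g /=.
  move=> Cg; apply/sqfree_primary => C' C'S.
  have [/(min_cover_sub CS C'S) ->|C'C] := boolP (C' \subset C).
    by rewrite mulrC; apply: PM.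
  have [_ _ PM'] := weight_ideal_ideal K 1 (indicator_ge0 C'); apply: PM'.
  by apply/weight_idealX; rewrite cover_weight mnm_supp_set finset.setCS.
move=> /sqfree_primary/(_ C CS)/(prime_idealM (cover_ideal_prime C))[//|].
by move/weight_idealX; rewrite cover_weight mnm_supp_set fintype.subxx.
Qed.

Lemma cover_ideal_pow C s :
  ideal_pow (cover_ideal C) s = weight_ideal (indicator F C) s%:R.
Proof.
apply/seteqP; split.
  by apply: ideal_pow_weight => //; apply: indicator_ge0.
move=> f Cf; apply: ideal_msupp => [|m /Cf]; first exact: ideal_pow_ideal.
rewrite dot_indicator_mnm ler_nat => sm.
apply: (@mem_ideal_pow _ _ _ _ (fun i : 'I_n => [set i]%SET) _
  (fun i => if i \in C then m i else 0%N)).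
- move=> i; case: ifP => // iC _; apply/weight_idealX.
  rewrite cover_weight mnm_supp_set finset.sub1set inE iC //.
- by rewrite -big_mkcond.
- move=> i; rewrite (bigD1 i) //= big1 => [|j ji].
    by rewrite inE eqxx muln1 addn0; case: ifP.
  by rewrite inE eq_sym (negPf ji) muln0.
Qed.

Lemma symbolic_powP s f : symbolic_pow I s f <->
  forall C, C \in covers -> weight_ideal (indicator F C) s%:R f.
Proof.
rewrite /symbolic_pow Ass_sqfree; split=> [sf C CS|Cf P [C CS <-]].
  by rewrite -cover_ideal_pow; apply: sf; exists C.
by rewrite cover_ideal_pow; apply: Cf.
Qed.

End SquarefreeMonomialIdeals.

(** * Facets of the Newton polyhedron as vertices of its blocking polyhedron *)

Section Hyperplanes.
Variables (R : realType) (n : nat).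
Implicit Types (W : {vspace 'rV[R]_n}) (H : set 'rV[R]_n) (u x d : 'rV[R]_n).

Lemma scalar_dotE (v : {scalar 'rV[R]_n}) :
  v =1 dot (\row_i v (delta_mx ord0 i)).
Proof.
move=> x; rewrite {1}(row_sum_delta x) linear_sum dotC.
by apply: eq_bigr => i _; rewrite linearZ /= mxE.
Qed.

Lemma hyperplane_dim W u x : (forall d, (d \in W) = (dot u d == 0)) ->
  dot u x != 0 -> \dim W = n.-1.
Proof.
move=> WE ux; have x0 : x != 0 by apply: contraNneq ux => ->; rewrite linear0.
have disj : (W :&: <[x]>)%VS = 0%VS.
  apply/eqP; rewrite -subv0; apply/subvP => d; rewrite memv_cap memv0.
  move=> /andP[+ /vlineP[k dE]]; rewrite dE WE linearZ mulf_eq0 (negPf ux) orbF.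
  by move=> /eqP ->; rewrite scale0r.
have full : (W + <[x]>)%VS = fullv.
  apply/vspaceP => d; rewrite memvf.
  rewrite -(subrK ((dot u d / dot u x) *: x) d) memv_add ?memvZ ?memv_line //.
  by rewrite WE linearB linearZ /= divfK ?subrr.
have := dimv_disjoint_sum disj.
by rewrite full dimvf /dim /= mul1n dim_vline x0 addn1 => /(congr1 predn) /= <-.
Qed.

(** A hyperplane of the affine space that misses the origin spans everything,
    hence determines the linear form that is constant on it up to scaling. *)
Lemma hyperplane_full W u x : (0 < n)%N -> \dim W = n.-1 ->
    (forall d, d \in W -> dot u d = 0) -> dot u x != 0 ->
  (W + <[x]>)%VS = fullv.
Proof.
move=> n0 dimW uW ux; have x0 : x != 0 by apply: contraNneq ux => ->; rewrite linear0.
apply/eqP; rewrite eqEdim subvf dimvf /dim /= mul1n.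
rewrite dimv_disjoint_sum ?dim_vline ?x0 ?dimW ?addn1 ?prednK //.
apply/eqP; rewrite -subv0; apply/subvP => d; rewrite memv_cap memv0.
move=> /andP[/uW + /vlineP[k dE]]; rewrite dE linearZ => /eqP.
by rewrite mulf_eq0 (negPf ux) orbF => /eqP ->; rewrite scale0r.
Qed.

Lemma affine_hull_affine (C : set 'rV[R]_n) : is_affine (affine_hull C).
Proof.
move=> x y t Cx Cy H HC; have [Haff _] := HC.
by apply: Haff; [apply: Cx|apply: Cy].
Qed.

Lemma affineZ H x d k : is_affine H -> H x -> H (x + d) -> H (x + k *: d).
Proof.
move=> Haff Hx Hd; have := Haff _ _ k Hd Hx.
by rewrite scalerDr addrAC -scalerDl addrC subrKC scale1r addrC.
Qed.

Lemma affineD H x d e :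
  is_affine H -> H x -> H (x + d) -> H (x + e) -> H (x + (d + e)).
Proof.
move=> Haff Hx Hd He.
have := Haff _ _ (2^-1) (affineZ 2 Haff Hx Hd) (affineZ 2 Haff Hx He).
have -> : 1 - 2^-1 = 2^-1 :> R by field.
rewrite !scalerDr !scalerA mulVf ?pnatr_eq0 // !scale1r addrACA -scalerDl.
by rewrite (_ : 2^-1 + 2^-1 = 1 :> R) ?scale1r //; field.
Qed.

End Hyperplanes.

Section Newton.
Variables (R : realType) (K : fieldType) (n : nat).
Variable I : set (mpoly n K).
Hypothesis I_sqfree : squarefree_monomial_ideal I.
Hypothesis I_nonzero : exists2 f, I f & f != 0.
Hypothesis I_proper : I <> setT.

Local Notation S := (sqfree_supports I).
Local Notation covers := (min_covers S).
Local Notation vec := (mnm_vec R).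
Local Notation ind := (indicator R).
Implicit Types (u w x d : 'rV[R]_n) (v : {scalar 'rV[R]_n}).
Implicit Types (m : multinom n) (J : set (mpoly n K)).

Lemma exponents_supp m : I (mpolyX K m) -> mnm_supp m \in S.
Proof.
by move=> /(mem_sqfree I_sqfree)/(_ m); apply; rewrite msuppX mem_head.
Qed.

Lemma vec_supp_le m i : ind (mnm_supp m) ord0 i <= vec m ord0 i.
Proof. by rewrite !mxE -mnm_setE ler_nat mnm_set_supp_le. Qed.

Lemma block_weight_ge1 u m :
  blocking S u -> I (mpolyX K m) -> 1 <= dot u (vec m).
Proof.
move=> Su /exponents_supp mS; have /blockingP[u_ge0 Su1] := Su.
apply: le_trans (Su1 _ mS) _; rewrite dotC; apply: ler_dot => // i.
exact: vec_supp_le.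
Qed.

(** With [d = 0] this says that [u] bounds the Newton polyhedron.  In general it
    controls the face cut out by [u]: a form that vanishes on the exponents
    and on the directions which generate the face vanishes on the face.  The
    set on the right is convex, and this avoids describing the points of the
    convex hull. *)
Lemma newton_face u d : blocking S u ->
    (forall i, u ord0 i = 0 -> d ord0 i = 0) ->
    (forall A, A \in S -> dot (ind A) u = 1 -> dot (ind A) d = 0) ->
  newton_polyhedron I `<=`
    [set x | 1 <= dot u x /\ (dot u x = 1 -> dot d x = 0)].
Proof.
move=> Su d0 dS; have /blockingP[u_ge0 Su1] := Su.
apply: smallest_sub.
  apply/convex_setW => x y /set_mem[x1 dx] /set_mem[y1 dy] k k0 k1.
  apply/mem_set; rewrite -[conv _ _ _]/(k%:num *: x + (1 - k%:num) *: y) /=.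
  have k'0 : 0 < 1 - k%:num by rewrite subr_gt0.
  rewrite !linearD !linearZ /=; split.
    have := ler_wpM2l (ltW k0) x1; have := ler_wpM2l (ltW k'0) y1.
    by rewrite !mulr1; lra.
  move=> e; have ex : dot u x = 1 /\ dot u y = 1.
    have kx : 0 <= k%:num * (dot u x - 1) by rewrite mulr_ge0 ?subr_ge0 // ltW.
    have ky : 0 <= (1 - k%:num) * (dot u y - 1).
      by rewrite mulr_ge0 ?subr_ge0 // ltW.
    have kx0 : k%:num * (dot u x - 1) = 0 by lra.
    have ky0 : (1 - k%:num) * (dot u y - 1) = 0 by lra.
    move: kx0 ky0 => /eqP + /eqP; rewrite !mulf_eq0 (gt_eqF k0) (gt_eqF k'0) /= !subr_eq0.
    by move=> /eqP ? /eqP.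
  by rewrite dx ?dy ?mulr0 ?addr0 //; case: ex.
move=> _ [m /= Im <-]; rewrite -/(vec m).
split; first exact: block_weight_ge1.
have mS := exponents_supp Im; set A := mnm_supp m in mS *.
have ge0 : 0 <= dot u (vec m - ind A).
  by apply: dot_ge0 => // i; have := vec_supp_le m i; rewrite !mxE subr_ge0.
move=> um1; have uA : dot u (ind A) = 1.
  apply/eqP; rewrite eq_le -{1}um1 -subr_ge0 -linearB /= ge0 /=.
  by rewrite dotC; apply: Su1.
have := dS A mS; rewrite dotC => /(_ uA); rewrite dotC => dA.
rewrite -(subrK (ind A) (vec m)) linearD /= dA addr0.
have : dot u (vec m - ind A) = 0 by rewrite linearB /= um1 uA subrr.
have ge0i i : 0 <= u ord0 i * (vec m - ind A) ord0 i.
  by rewrite mulr_ge0 //; have := vec_supp_le m i; rewrite !mxE subr_ge0.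
move/eqP; rewrite psumr_eq0 // => /allP u0; apply: big1 => i _.
have := u0 i (mem_index_enum i); rewrite mulf_eq0 => /orP[/eqP ui|/eqP ->].
  by rewrite d0 ?mul0r.
by rewrite mulr0.
Qed.

Lemma n_gt0 : (0 < n)%N.
Proof.
have /finset.set0Pn[A AS] := sqfree_supports_neq0 I_sqfree I_nonzero.
rewrite lt0n; apply: contra (sqfree_set0 I_sqfree I_proper) => /eqP n0.
rewrite (_ : finset.set0 = A) //; apply/setP => i; have := ltn_ord i.
by rewrite [X in (_ < X)%N]n0.
Qed.

Lemma skew_valueE v J m0 : J (mpolyX K m0) ->
    (forall m, J (mpolyX K m) -> v (vec m0) <= v (vec m)) ->
  skew_value v J = v (vec m0).
Proof.
move=> Jm0 min_m0; apply: xget_unique => [|y [[x [m Jm <-]] <-] lb].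
  split; first by exists (vec m0) => //; exists m0.
  by move=> _ [_ [m Jm <-] <-]; apply: min_m0.
apply/eqP; rewrite eq_le min_m0 // andbT; apply: lb.
by exists (vec m0) => //; exists m0.
Qed.

Lemma skew_value_vertex v u c : block_vertex S u -> 0 <= c ->
  (forall x, v x = c * dot u x) -> skew_value v I = c.
Proof.
move=> vu c_ge0 vE; have /block_vertexP[Su _] := vu.
have /finset.set0Pn[A1 A1S] := sqfree_supports_neq0 I_sqfree I_nonzero.
have [A AS uA] := block_vertex_tight vu A1S.
have vA : v (vec (mnm_set A)) = c by rewrite vE mnm_vec_set dotC uA mulr1.
rewrite (@skew_valueE _ _ (mnm_set A)) //; first exact/sqfree_supportsP.
by move=> m Im; rewrite vA vE ler_peMr // block_weight_ge1.
Qed.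

(** The tight constraints at a vertex span the whole space; among their
    combinations, those on which [u] vanishes are exactly the combinations of
    differences of points of the face cut out by [u], which is thus of
    codimension one. *)
Lemma facet_of_vertex u : block_vertex S u ->
  newton_skew_valuations I (dot u : {scalar 'rV[R]_n}).
Proof.
move=> vu; have /block_vertexP[Su _] := vu; have /blockingP[u_ge0 Su1] := Su.
have /finset.set0Pn[A1 A1S] := sqfree_supports_neq0 I_sqfree I_nonzero.
have [A AS uA] := block_vertex_tight vu A1S.
have IA : I (mpolyX K (mnm_set A)) by apply/sqfree_supportsP.
have {}uA : dot u (ind A) = 1 by rewrite dotC.
have NPe m : I (mpolyX K m) -> newton_polyhedron I (vec m).
  by move=> Im; apply: sub_gen_smallest; exists m.
split.
- by move=> x x_ge0; apply: dot_ge0.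
- by rewrite /supported (skew_value_vertex vu ler01) // => x; rewrite mul1r.
exists 1; split=> [//|x /(newton_face Su (d := 0))|].
  by case=> // [i _|B _ _]; rewrite ?linear0 ?mxE.
pose W := lker (linfun (mulmxr u^T : 'rV[R]_n -> 'rV[R]_1)).
have WE d : (d \in W) = (dot u d == 0).
  rewrite memv_ker lfunE /= dotEmx; apply/eqP/eqP => [->|d0].
    by rewrite mxE.
  by apply/matrixP => i j; rewrite !ord1 d0 mxE.
set face := _ `&` _; have faceA B : B \in S -> dot u (ind B) = 1 -> face (ind B).
  by move=> BS uB; split=> //; rewrite -mnm_vec_set; apply: NPe; apply/sqfree_supportsP.
exists (ind A), W; split.
- by exists (ind A); apply: faceA.
- by apply: (hyperplane_dim (x := ind A) WE); rewrite uA oner_neq0.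
apply/seteqP; split.
  apply: smallest_sub => [_ _ t [d dW <-] [e eW <-]|x [_ /= ux]].
    exists (t *: d + (1 - t) *: e).
      by rewrite /= memvD ?memvZ.
    by rewrite !scalerDr addrACA -scalerDl [t + _]addrC subrK scale1r.
  exists (x - ind A); last by rewrite subrKC.
  by rewrite /= WE linearB /= uA subr_eq0; apply/eqP.
set H := affine_hull face; have Haff := @affine_hull_affine _ _ face.
have Hface x : face x -> H x by apply: sub_gen_smallest.
have HA : H (ind A) by apply: Hface; apply: faceA.
move=> _ [d /= dW <-]; move: dW; rewrite WE => /eqP ud.
have [y [z [y0 z0 dE]]] := block_vertex_span d vu.
have ydot B : y B * dot u (ind B) = y B.
  have [[_ uB]|/y0 ->] := pselect (B \in S /\ dot (ind B) u = 1).
    by rewrite dotC uB mulr1.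
  by rewrite mul0r.
have zdot i : z i * u ord0 i = 0.
  by have [->|/z0 ->] := eqVneq (u ord0 i) 0; rewrite ?mulr0 ?mul0r.
have sum_y : \sum_B y B = 0.
  rewrite -[RHS]ud dE linearD !linear_sum /= [X in _ + X]big1 ?addr0.
    by apply: eq_bigr => B _; rewrite linearZ /= ydot.
  by move=> i _; rewrite linearZ /= dot_delta zdot.
have -> : d = \sum_B y B *: (ind B - ind A) + \sum_i z i *: delta_mx ord0 i.
  rewrite {1}dE; congr (_ + _); under [RHS]eq_bigr do rewrite scalerBr.
  by rewrite sumrB -scaler_suml sum_y scale0r subr0.
apply: (affineD Haff HA).
  apply: (big_ind (fun e => H (ind A + e))) => [|e e'|B _].
  - by rewrite addr0.
  - exact: affineD Haff HA.
  have [[BS uB]|/y0 ->] := pselect (B \in S /\ dot (ind B) u = 1).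
    apply: (affineZ _ Haff HA); rewrite subrKC; apply: Hface.
    by apply: faceA; rewrite // dotC.
  by rewrite scale0r addr0.
apply: (big_ind (fun e => H (ind A + e))) => [|e e'|i _].
- by rewrite addr0.
- exact: affineD Haff HA.
have [ui|/z0 ->] := eqVneq (u ord0 i) 0; last by rewrite scale0r addr0.
apply: (affineZ _ Haff HA); apply: Hface.
have -> : ind A + delta_mx ord0 i = vec (mnm_add (mnm1 i) (mnm_set A)).
  rewrite mnm_vecD mnm_vec_set addrC; congr (_ + _).
  by apply/rowP => j; rewrite !mxE mnm1E eqxx eq_sym.
split.
  apply: NPe; rewrite mpolyXD; have [_ _ IM] := sqfree_ideal I_sqfree.
  exact: IM.
rewrite /hyperplane /= mnm_vecD mnm_vec_set linearD /= uA.
rewrite (_ : vec (mnm1 i) = delta_mx ord0 i) ?dot_delta ?ui ?add0r //.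
by apply/rowP => j; rewrite !mxE mnm1E eqxx eq_sym.
Qed.

(** Scale [v] so that it is [1] on its facet.  If [d] vanishes on all
    constraints that are tight at [u], it vanishes on the facet by
    [newton_face], hence on its affine hull, which spans the space. *)
Lemma vertex_of_facet v : newton_skew_valuations I v ->
  exists (u : 'rV[R]_n) (c : R),
    [/\ block_vertex S u, 0 < c & forall x, v x = c * dot u x].
Proof.
move=> [v_ge0 _ [c [c_gt0 NPv]]] [x0 [W [[xf [xfNP xfc]] dimW hullE]]].
pose u := \row_i (c^-1 * v (delta_mx ord0 i)).
have vE x : v x = c * dot u x.
  rewrite scalar_dotE /dot mulr_sumr; apply: eq_bigr => i _.
  by rewrite !mxE mulrA mulVKf // gt_eqF.
have NPe m : I (mpolyX K m) -> newton_polyhedron I (vec m).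
  by move=> Im; apply: sub_gen_smallest; exists m.
have Su : blocking S u.
  apply/blockingP; split=> [i|A AS].
    rewrite mxE mulr_ge0 ?invr_ge0 ?(ltW c_gt0) //; apply: v_ge0 => j.
    by rewrite mxE.
  have := NPv (vec (mnm_set A)); rewrite /half_space /= vE mnm_vec_set dotC.
  by rewrite ler_pMr //; apply; rewrite -mnm_vec_set; apply: NPe; apply/sqfree_supportsP.
exists u, c; split=> //; apply/block_vertexP; split=> // d d0 dS.
have face_u x : (newton_polyhedron I `&` hyperplane v c) x -> dot u x = 1.
  move=> [_ /= ]; rewrite /hyperplane /= vE => /(congr1 ( *%R c^-1)).
  by rewrite mulKf ?mulVf // gt_eqF.
have face_d x : (newton_polyhedron I `&` hyperplane v c) x -> dot d x = 0.
  by move=> fx; have [/(newton_face Su d0 dS)[_] + _] := fx; apply; apply: face_u.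
have hull_dot w k : (forall x, (newton_polyhedron I `&` hyperplane v c) x ->
    dot w x = k) -> dot w x0 = k /\ forall e, e \in W -> dot w e = 0.
  move=> wk; have hull_k x : x0 + x \in [set x0 + e | e in [set` W]] -> dot w (x0 + x) = k.
    rewrite -hullE => /set_mem; apply: (@smallest_sub _ _ _ [set x | dot w x = k]) => //.
    by move=> y z t /= wy wz; rewrite linearD !linearZ /= wy wz; ring.
  have hx0 : dot w x0 = k.
    rewrite -[x0]addr0; apply: hull_k; apply/mem_set; exists 0 => //=.
    exact: mem0v.
  split=> // e eW; have := hull_k e; rewrite linearD /= hx0 => h.
  by apply: (addrI k); rewrite addr0; apply: h; apply/mem_set; exists e.
have [ux0 uW] := hull_dot u 1 face_u; have [dx0 dW] := hull_dot d 0 face_d.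
have ux0_neq0 : dot u x0 != 0 by rewrite ux0 oner_neq0.
apply: dot_inj => x; rewrite [RHS]dotC linear0.
have : x \in (W + <[x0]>)%VS by rewrite (hyperplane_full n_gt0 dimW uW) // memvf.
move=> /memv_addP[e eW [_ /vlineP[k ->] ->]].
by rewrite linearD linearZ /= dx0 dW // mulr0 addr0.
Qed.

End Newton.

(** * Waldschmidt constants and the asymptotic resurgence *)

Section Resurgence.
Variables (R : realType) (K : fieldType) (n : nat).
Variable I : set (mpoly n K).
Hypothesis I_sqfree : squarefree_monomial_ideal I.
Hypothesis I_nonzero : exists2 f, I f & f != 0.
Hypothesis I_proper : I <> setT.

Local Notation S := (sqfree_supports I).
Local Notation covers := (min_covers S).
Local Notation vec := (mnm_vec R).
Local Notation ind := (indicator R).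
Implicit Types (u w x y : 'rV[R]_n) (v : {scalar 'rV[R]_n}).
Implicit Types (m : multinom n) (s t r : nat).

Let covers0 : finset.set0 \notin covers.
Proof. exact: min_coverN0 (sqfree_supports_neq0 I_sqfree I_nonzero). Qed.

Lemma symbolic_powXP s m : symbolic_pow I s (mpolyX K m) <->
  forall C, C \in covers -> (s <= \sum_(i in C) m i)%N.
Proof.
rewrite (symbolic_powP R I_sqfree).
split=> sC C CS; have := sC C CS.
  by move/weight_idealX; rewrite dot_indicator_mnm ler_nat.
by move=> ?; apply/weight_idealX; rewrite dot_indicator_mnm ler_nat.
Qed.

Lemma symbolic_pow_blocking s m : (0 < s)%N -> symbolic_pow I s (mpolyX K m) ->
  blocking covers (s%:R^-1 *: vec m).
Proof.
move=> s0 /symbolic_powXP sm; apply/blockingP; split=> [i|C CS].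
  by rewrite !mxE mulr_ge0 ?invr_ge0.
by rewrite linearZ /= ler_pdivlMl ?ltr0n // mulr1 dot_indicator_mnm ler_nat sm.
Qed.

(** Round each coordinate of [s *: x] up to the next integer. *)
Lemma symbolic_pow_ceil s x : blocking covers x ->
  exists2 m, symbolic_pow I s (mpolyX K m) &
    forall i, vec m ord0 i <= s%:R * x ord0 i + 1.
Proof.
move=> /blockingP[x_ge0 xC].
exists (Multinom (mktuple (fun i => (Num.truncn (s%:R * x ord0 i)).+1))).
  apply/symbolic_powXP => C CS; rewrite -(ler_nat R) natr_sum.
  have := ler_wpM2l (ler0n R s) (xC C CS); rewrite mulr1 dot_indicator mulr_sumr.
  move=> /le_trans; apply; apply: ler_sum => i _.
  by rewrite mnmE ltW // truncnS_gt.
by move=> i; rewrite !mxE mnmE -natr1 lerD2r truncn_le mulr_ge0.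
Qed.

(** Truncating exponents at [s] preserves membership in the symbolic power and
    does not increase the weight, so it suffices to search a finite box. *)
Lemma symbolic_pow_min s w : (forall i, 0 <= w ord0 i) ->
  exists2 m, symbolic_pow I s (mpolyX K m) &
    forall m', symbolic_pow I s (mpolyX K m') -> dot w (vec m) <= dot w (vec m').
Proof.
move=> w_ge0.
pose mn (f : {ffun 'I_n -> 'I_s.+1}) : multinom n :=
  Multinom (mktuple (fun i => f i : nat)).
pose trunc m : {ffun 'I_n -> 'I_s.+1} := [ffun i => inord (minn (m i) s)].
have mn_trunc m i : mn (trunc m) i = minn (m i) s.
  by rewrite mnmE ffunE inordK // ltnS geq_minr.
have sym_trunc m : symbolic_pow I s (mpolyX K m) ->
    symbolic_pow I s (mpolyX K (mn (trunc m))).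
  move=> /symbolic_powXP sm; apply/symbolic_powXP => C CS.
  have [/exists_inP[i iC smi]|/exists_inPn msmall] :=
    boolP [exists i in C, (s <= m i)%N].
    by rewrite (bigD1 i) //= mn_trunc (minn_idPr smi) leq_addr.
  rewrite (eq_bigr (fun i => m i)) ?sm // => i iC.
  by rewrite mn_trunc (minn_idPl _) // ltnW // ltnNge msmall.
pose m1 : multinom n := Multinom (mktuple (fun=> s)).
have sym1 : symbolic_pow I s (mpolyX K m1).
  apply/symbolic_powXP => C CS; have /finset.set0Pn[i iC] : C != finset.set0.
    by apply: contraNneq covers0 => <-.
  by rewrite (bigD1 i) //= mnmE leq_addr.
have [f fsym fmin] := @finite_argmin _ _
  [set f | symbolic_pow I s (mpolyX K (mn f))] (fun f => dot w (vec (mn f)))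
  finite_finset (ex_intro _ (trunc m1) (sym_trunc _ sym1)).
exists (mn f) => // m /sym_trunc/fmin/le_trans; apply.
by apply: ler_dot => // i; rewrite !mxE ler_nat mn_trunc geq_minl.
Qed.

(** The exponents in the [s]-th symbolic power are the lattice points of [s]
    times the symbolic polyhedron, so that the least weight differs from [s]
    times the minimum over that polyhedron by a bounded amount. *)
Lemma skew_waldschmidtE v w x : v =1 dot w -> (forall i, 0 <= w ord0 i) ->
    blocking covers x -> (forall y, blocking covers y -> dot w x <= dot w y) ->
  skew_waldschmidt v I = dot w x.
Proof.
move=> vw w_ge0 xC x_min; apply: cvg_lim => //; apply/cvgrPdist_le => e e0.
pose D := dot w (const_mx 1).
near=> s; have s0 : (0 < s)%N by near: s; apply: nbhs_infty_gt.
have [m sm m_min] := symbolic_pow_min s w_ge0.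
rewrite (@skew_valueE _ _ _ v _ m sm) ?vw; last first.
  by move=> m' /m_min; rewrite !vw.
have lb : dot w x <= dot w (vec m) / s%:R.
  have := x_min _ (symbolic_pow_blocking s0 sm).
  by rewrite linearZ /= mulrC.
have ub : dot w (vec m) / s%:R <= dot w x + D / s%:R.
  have [m' sm' m'_le] := symbolic_pow_ceil s xC.
  rewrite ler_pdivrMr ?ltr0n // mulrDl divfK ?pnatr_eq0 -?lt0n //.
  apply: le_trans (m_min _ sm') _; rewrite mulrC -[X in X + _]linearZ -linearD /=.
  by apply: ler_dot => // i; rewrite (le_trans (m'_le i)) // !mxE.
have De : D / s%:R <= e.
  rewrite ler_pdivrMr ?ltr0n // -ler_pdivrMl // ltW //.
  by near: s; apply: nbhs_infty_gtr.
by rewrite distrC ger0_norm ?subr_ge0 // lerBlDl (le_trans ub) // lerD2l.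
Unshelve. all: by end_near. Qed.

(** If the product were [0], the support of [x] would be disjoint from that of
    [u]; but it meets all the minimal covers, so it is a member of [S], and
    [u] has weight at least [1] on it. *)
Lemma blocking_dot_gt0 u x : blocking S u -> blocking covers x -> 0 < dot u x.
Proof.
move=> /blockingP[u_ge0 uS] /blockingP[x_ge0 xC].
rewrite lt_neqAle dot_ge0 // andbT eq_sym; apply/negP.
rewrite psumr_eq0 => [/allP ux0|i _]; last by rewrite mulr_ge0.
pose A := [set i | x ord0 i != 0]%SET.
have AS : A \in S.
  apply/(mem_blocker _ (sqfree_supports_up I_sqfree)) => C CS.
  apply/negP => /fintype.subsetP AC; have := xC C CS.
  rewrite dot_indicator big1 ?ler10 // => i iC; apply/eqP.
  by apply: contraTT iC => xi; have := AC i; rewrite !inE xi; apply.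
have := uS A AS; rewrite dot_indicator big1 ?ler10 // => i; rewrite inE => xi.
have := ux0 i (mem_index_enum i).
by rewrite mulf_eq0 (negPf xi) orbF => /eqP.
Qed.

(** Duality writes the exponent as dominating a nonnegative real combination
    of exponents of squarefree monomials of [I]; rounding the coefficients
    down loses less than one for each squarefree monomial. *)
Lemma mem_ideal_pow_blocking r m :
    (forall u, blocking S u -> (r + #|{: {set 'I_n}}|)%:R <= dot u (vec m)) ->
  ideal_pow I r (mpolyX K m).
Proof.
move=> rm; have := @blocking_duality R n S (vec m) (r + #|{: {set 'I_n}}|)%:R.
case=> [i|u Su|l [l_ge0 lm lr]]; first exact: mnm_vec_ge0.
  by rewrite dotC; apply: rm.
apply: (@mem_ideal_pow _ _ _ _ id _
  (fun A => if A \in S then Num.truncn (l A) else 0%N)).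
- by move=> A; case: ifP => // /sqfree_supportsP.
- rewrite -(ler_nat R) natr_sum -(lerD2r #|{: {set 'I_n}}|%:R) -natrD.
  apply: le_trans lr _; rewrite big_mkcond /=.
  rewrite -sum1_card natr_sum -big_split /=; apply: ler_sum => A _.
  by case: ifP => _; rewrite ?addr_ge0 // natr1 ltW // truncnS_gt.
move=> i; rewrite -(ler_nat R) natr_sum; have := lm i; rewrite [X in _ <= X]mxE.
apply: le_trans; rewrite [X in _ <= X]big_mkcond /=; apply: ler_sum => A _.
case: ifP => _; last by rewrite mul0n.
by rewrite natrM ler_wpM2r // truncn_le.
Qed.

Lemma blocking_dot_min : exists (u x : 'rV[R]_n),
  [/\ block_vertex S u, block_vertex covers x &
      forall u' x', blocking S u' -> blocking covers x' -> dot u x <= dot u' x'].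
Proof.
have S0 := sqfree_set0 I_sqfree I_proper.
have ge0 G y : blocking G y -> forall i, 0 <= y ord0 i by move=> /blockingP[].
have ge00 i : 0 <= (0 : 'rV[R]_n) ord0 i by rewrite mxE.
have [u0 vu0 _] := blocking_minimum ge00 S0.
have [x0 vx0 _] := blocking_minimum ge00 covers0.
have [[u x] [/= vu vx] min_ux] := @finite_argmin R _
  (block_vertex S `*` block_vertex covers) (fun p => dot p.1 p.2)
  (finite_setX (vertex_finite _ _) (vertex_finite _ _))
  (ex_intro _ (u0, x0) (conj vu0 vx0)).
exists u, x; split=> // u' x' Su' Cx'.
have [x1 vx1 /(_ x' Cx') le1] := blocking_minimum (ge0 _ _ Su') covers0.
have [Cx1 _] := vx1.
have [u1 vu1 /(_ u' Su') le2] := blocking_minimum (ge0 _ _ Cx1) S0.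
apply: le_trans le1; rewrite [X in _ <= X]dotC; apply: le_trans le2.
by rewrite dotC [X in _ <= X]dotC dotC; apply: (min_ux (u1, x1)).
Qed.

(** If [r < s * k], where [k] is the minimum, every exponent [m] in the
    symbolic power of order [s * t] has [dot u' m >= s * t * k] for all [u'],
    which exceeds [r * t] by as much as [mem_ideal_pow_blocking] requires once
    [t] is large.  If [s * k < r], rounding up [s * t *: x] gives a monomial
    of the symbolic power on which [u] is less than [r * t]. *)
Lemma asymptotic_resurgenceE u x : blocking S u -> blocking covers x ->
    (forall u' x', blocking S u' -> blocking covers x' ->
      dot u x <= dot u' x') ->
  asymptotic_resurgence R I = ((dot u x)^-1)%:E.
Proof.
move=> Su Cx ux_min; set k := dot u x.
have k_gt0 : 0 < k by apply: blocking_dot_gt0.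
have /blockingP[u_ge0 _] := Su.
apply/eqP; rewrite eq_le; apply/andP; split.
  apply: ge_ereal_sup => _ [s [r [s0 r0 -> not_sub]]].
  rewrite lee_fin leNgt; apply/negP => lt_k.
  have sk_r : 0 < s%:R * k - r%:R.
    by rewrite subr_gt0 -ltr_pdivrMr // mulrC -ltr_pdivlMr ?ltr0n // mulrC.
  have sub : \forall t \near \oo,
      symbolic_pow I (s * t) `<=` ideal_pow I (r * t).
    near=> t => f sf; have t0 : (0 < t)%N by near: t; apply: nbhs_infty_gt.
    apply: ideal_msupp => [|m mf]; first exact: ideal_pow_ideal.
    apply: mem_ideal_pow_blocking => u' Su'.
    have st0 : (0 < s * t)%N by rewrite muln_gt0 s0.
    have sm : symbolic_pow I (s * t) (mpolyX K m).
      apply/(symbolic_powP R I_sqfree) => C CS.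
      apply/weight_idealX.
      by have /(symbolic_powP R I_sqfree)/(_ C CS) := sf; apply.
    have := ux_min _ _ Su' (symbolic_pow_blocking st0 sm).
    rewrite linearZ /= ler_pdivlMl ?ltr0n // -/k; apply: le_trans.
    rewrite natrD !natrM -lerBrDl mulrAC -mulrBl mulrC -ler_pdivrMr //.
    by apply/ltW; near: t; apply: nbhs_infty_gtr.
  have [t [] // ] := filter_ex (filterI not_sub sub).
apply/lee_addgt0Pr => e e0.
(* The best fraction below [k^-1] with numerator [s] is within
   [1 / (s * k ^+ 2)] of it. *)
pose s := (Num.truncn (k ^- 2 / e)).+1; pose r := (Num.truncn (s%:R * k)).+1.
have s_gt : k ^- 2 / e < s%:R by apply: truncnS_gt.
have r_gt : s%:R * k < r%:R by apply: truncnS_gt.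
have r_le : r%:R <= s%:R * k + 1.
  by rewrite -natr1 lerD2r truncn_le mulr_ge0 // ltW.
have sr_mem : ((s%:R / r%:R)%:E <= asymptotic_resurgence R I)%E.
  apply: ereal_sup_ubound; exists s, r; split=> //.
  near=> t => sub; have [m sm m_le] := symbolic_pow_ceil (s * t) Cx.
  have I_weight : I `<=` weight_ideal u 1.
    move=> f If m' m'f; apply: (block_weight_ge1 I_sqfree Su).
    apply/(mem_sqfree I_sqfree) => m''; rewrite msuppX inE => /eqP ->.
    exact: (mem_sqfree I_sqfree f).1 If _ m'f.
  have /weight_idealX := ideal_pow_weight u_ge0 I_weight (sub _ sm).
  have : dot u (vec m) <= (s * t)%:R * k + dot u (const_mx 1).
    rewrite -[X in X + _]linearZ -linearD /=; apply: ler_dot => // i.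
    by rewrite (le_trans (m_le i)) // !mxE.
  move=> le_D; apply/negP; rewrite -ltNge; apply: le_lt_trans le_D _.
  rewrite !natrM -ltrBrDl mulrAC -mulrBl mulrC -ltr_pdivrMr ?subr_gt0 //.
  by near: t; apply: nbhs_infty_gtr.
apply: le_trans (leeD2r _ sr_mem); rewrite -EFinD lee_fin.
have sek : k^-1 <= s%:R * e * k.
  have : k ^- 2 * k <= s%:R * e * k.
    by rewrite ler_wpM2r ?(ltW k_gt0) // -ler_pdivrMr // ltW.
  by rewrite -exprVn expr2 mulfVK // gt_eqF.
rewrite -lerBlDr ler_pdivlMr ?ltr0n //.
have [le0|gt0] := lerP (k^-1 - e) 0.
  by apply: le_trans (ler0n _ _); rewrite mulr_le0_ge0.
apply: le_trans (ler_wpM2l (ltW gt0) r_le) _.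
have -> : (k^-1 - e) * (s%:R * k + 1) = s%:R + (k^-1 - e - s%:R * e * k).
  by field; rewrite gt_eqF.
by rewrite gerDl; lra.
Unshelve. all: by end_near. Qed.

End Resurgence.

Section Conclusion.
Variables (R : realType) (K : fieldType) (n : nat).
Variable I : set (mpoly n K).
Hypothesis I_sqfree : squarefree_monomial_ideal I.
Hypothesis I_nonzero : exists2 f, I f & f != 0.
Implicit Types (v : {scalar 'rV[R]_n}).

Lemma skew_resurgenceE v (u x : 'rV[R]_n) c :
    block_vertex (sqfree_supports I) u -> 0 < c ->
    (forall y, v y = c * dot u y) ->
    blocking (min_covers (sqfree_supports I)) x ->
    (forall y, blocking (min_covers (sqfree_supports I)) y ->
      dot u x <= dot u y) ->
  skew_resurgence v I = (dot u x)^-1.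
Proof.
move=> vu c_gt0 vE Cx x_min; have /block_vertexP[/blockingP[u_ge0 _] _] := vu.
rewrite /skew_resurgence (skew_value_vertex I_sqfree I_nonzero vu (ltW c_gt0) vE).
have cE y : dot (c *: u) y = c * dot u y.
  by rewrite dotC linearZ /= dotC.
rewrite (@skew_waldschmidtE _ _ _ _ I_sqfree I_nonzero v (c *: u) x) //.
- by rewrite cE invfM mulrA divff ?mul1r // gt_eqF.
- by move=> y; rewrite vE cE.
- by move=> i; rewrite mxE mulr_ge0 // ltW.
- by move=> y /x_min ?; rewrite !cE ler_pM2l.
Qed.

End Conclusion.

Theorem corollary2p16 (R : realType) (K : fieldType) (n : nat)
    (I : set (mpoly n K))
    (I_sqfree : squarefree_monomial_ideal I)
    (I_nonzero : exists2 f, I f & f != 0)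
    (I_proper : I <> setT) :
  [/\ (* finitely many skew valuations up to positive scaling *)
      exists (k : nat) (F : 'I_k -> {scalar 'rV[R]_n}),
        forall v, newton_skew_valuations I v ->
          exists (i : 'I_k) (a : R), 0 < a /\ forall x, v x = a * F i x,
      (* the asymptotic resurgence is the maximum of the skew resurgences *)
      let V : set (\bar R) :=
        [set (skew_resurgence v I)%:E | v in newton_skew_valuations (R := R) I] in
      (V `&` ubound V) (asymptotic_resurgence R I)
    & exists q : rat, asymptotic_resurgence R I = (ratr q)%:E].
Proof.
set S := sqfree_supports I.
have [u [x [vu vx ux_min]]] := blocking_dot_min R I_sqfree I_nonzero I_proper.
have [[Su _] [Cx _]] := (vu, vx).
have rhoE := asymptotic_resurgenceE I_sqfree Su Cx ux_min.
split.
- have /finite_seqP[s sE] :=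
    vertex_finite (@block_row R n S) (@block_rhs R n S).
  exists (size s), (fun i => dot (nth 0 s i) : {scalar 'rV[R]_n}) => v Nv.
  have [u' [c [vu' c_gt0 vE]]] := vertex_of_facet I_sqfree I_nonzero I_proper Nv.
  have u's : u' \in s by move: vu'; rewrite /block_vertex sE.
  have lt_s : (index u' s < size s)%N by rewrite index_mem.
  by exists (Ordinal lt_s), c; rewrite /= nth_index.
- rewrite rhoE; split.
    exists (dot u : {scalar 'rV[R]_n}); first exact: facet_of_vertex.
    congr (_%:E); apply: (skew_resurgenceE I_sqfree I_nonzero vu ltr01) => //.
      by move=> y; rewrite mul1r.
    by move=> y; apply: ux_min.
  move=> _ [v Nv <-].
  have [u' [c [vu' c_gt0 vE]]] := vertex_of_facet I_sqfree I_nonzero I_proper Nv.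
  have /block_vertexP[Su' _] := vu'; have /blockingP[u'_ge0 _] := Su'.
  have [y [Cy _] y_min] := blocking_minimum u'_ge0
    (min_coverN0 (sqfree_supports_neq0 I_sqfree I_nonzero)).
  rewrite (skew_resurgenceE I_sqfree I_nonzero vu' c_gt0 vE Cy y_min) lee_fin.
  have pos := blocking_dot_gt0 I_sqfree.
  by rewrite lef_pV2 ?posrE; [apply: ux_min|apply: pos|apply: pos].
have [qu uE] := block_vertex_rational vu; have [qx xE] := block_vertex_rational vx.
exists (dot qu qx)^-1; rewrite rhoE fmorphV; congr (_^-1%:E).
rewrite uE xE rmorph_sum; apply: eq_bigr => i _.
by rewrite !mxE rmorphM.
Qed.
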